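(* Let $\mathcal{X}\subset\mathbb{R}^N$ be a set of $n$ points in general position. Assume that the birth times of different intervals (other than the vertices) of the generalized discrete gradient $V$ of the Čech birth time function of $\mathcal{X}$ are different. Let $N_k$ $(k=1,\dots,N)$ be the number of critical $k$-simplices in $\{\mathcal{C}_t(\mathcal{X})\}_{t\ge0}$. Let $\#PD_q$ denote the number of points in the $q$th persistence diagram of $\{\mathcal{C}_t(\mathcal{X})\}_{t\ge0}$. Then $$\#PD_0=n,\qquad \#PD_1=N_1-(n-1),\ \dots,$$ $$\#PD_q=N_q-N_{q-1}+\cdots+(-1)^{q-1}N_1+(-1)^q(n-1),\qquad 1\le q\le N-1.$$
   Context: A finite set $\mathcal{X}\subset\mathbb{R}^N$ is in general position if for every (nonempty) $\mathcal{P}\subset\mathcal{X}$ of at most $N+1$ points, (i) $\mathcal{P}$ is affinely independent, and (ii) no point of $\mathcal{X}\setminus\mathcal{P}$ lies on the smallest circumsphere of $\mathcal{P}$. The Čech complex is $\mathcal{C}_t(\mathcal{X})=\{\emptyset\neq\sigma\subset\mathcal{X}:\bigcap_{x\in\sigma}\bar B_t(x)\neq\emptyset\}$, $t\ge0$, where $\bar B_t(x)$ is the closed Euclidean ball of radius $t$ centered at $x$. A $k$-simplex is a subset of $\mathcal{X}$ of cardinality $k+1$. The birth time of $\sigma$ is $f(\sigma)=\inf\{t\ge0:\sigma\in\mathcal{C}_t(\mathcal{X})\}$. For $\tau\subset\sigma$, $[\tau,\sigma]=\{\alpha:\tau\subset\alpha\subset\sigma\}$ is an interval of simplices. Given a partition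 $V$ of a simplicial complex into intervals, a function $f$ on the simplices is a generalized discrete Morse function with generalized discrete gradient $V$ if (i) $f(\tau)\le f(\sigma)$ whenever $\tau\subset\sigma$; (ii) for $\tau\subset\sigma$, $f(\tau)=f(\sigma)$ iff $\tau$ and $\sigma$ belong to the same interval of $V$. It is known (Bauer–Edelsbrunner) that for $\mathcal{X}$ in general position the birth time function $f$, on the complex of all nonempty subsets of $\mathcal{X}$, is a generalized discrete Morse function with respect to some $V$; this is the $V$ in the claim. The birth time of an interval is the common value of $f$ on it. Under the assumption of the claim, with $\mathcal{C}_t=\mathcal{C}_t(\mathcal{X})$ and $\mathcal{C}_t^-=\bigcup_{s<t}\mathcal{C}_s$, for each $t>0$ one has $\mathcal{C}_t=\mathcal{C}_t^-$, or $\mathcal{C}_t=\mathcal{C}_t^-\sqcup\{\alpha\}$, or $\mathcal{C}_t=\mathcal{C}_t^-\sqcup[\tau,\sigma]$ with $\tau\subsetneq\sigma$. A $k$-simplex $\alpha$ occurring in the second case is called a critical $k$-simplex. Persistence diagrams are those of persistent homology (not reduced) with coefficients in a fixed field; points $(b,d)$ have $0\le b<d\le\infty$, are counted with multiplicity, and points with $d=\infty$ are included in $\#PD_q$. *)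

(* Defs.v *)
From HB Require Import structures.
From mathcomp Require Import boolp classical_sets reals constructive_ereal.
From mathcomp Require Import all_boot all_order all_algebra.
Set Implicit Arguments.
Unset Strict Implicit.
Unset Printing Implicit Defensive.
Import Order.TTheory GRing.Theory Num.Theory.
Local Open Scope ring_scope.

(* A set of n points of R^N is given by an injective x : 'I_n -> 'rV[R]_N;
   simplices are sets of indices. *)

Section Geometry.
Context {R : realType} {N n : nat}.
Implicit Types (x : 'I_n -> 'rV[R]_N) (P : {set 'I_n}).

(* The library norm on 'rV[R]_N is the sup norm. *)
Definition edist (u v : 'rV[R]_N) : R :=
  Num.sqrt (\sum_j (u 0 j - v 0 j) ^+ 2).

Definition affinely_independent x P : Prop :=
  forall l : 'I_n -> R,
    \sum_(i in P) l i = 0 -> \sum_(i in P) l i *: x i = 0 ->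
    forall i, i \in P -> l i = 0.

Definition circumsphere x P (c : 'rV[R]_N) (r : R) : Prop :=
  0 <= r /\ forall i, i \in P -> edist (x i) c = r.

Definition smallest_circumsphere x P (c : 'rV[R]_N) (r : R) : Prop :=
  circumsphere x P c r /\
  forall c' r', circumsphere x P c' r' -> r <= r'.

Definition general_position x : Prop :=
  forall P, P != set0 -> (#|P| <= N.+1)%N ->
    affinely_independent x P /\
    forall c r, smallest_circumsphere x P c r ->
      forall j, j \notin P -> edist (x j) c <> r.

Definition cech x (t : R) : {set {set 'I_n}} :=
  [set s : {set 'I_n} | (s != set0) &&
     `[< exists y : 'rV[R]_N, forall i, i \in s -> edist y (x i) <= t >]].

Definition cech_before x (t : R) : {set {set 'I_n}} :=
  [set s : {set 'I_n} | `[< exists u : R, 0 <= u < t /\ s \in cech x u >]].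

Definition birth_time x (s : {set 'I_n}) : R :=
  inf [set t : R | 0 <= t /\ s \in cech x t]%classic.

Definition critical x (a : {set 'I_n}) : Prop :=
  exists t : R, [/\ 0 < t, a \notin cech_before x t
                  & cech x t = a |: cech_before x t].

Definition num_critical x (k : nat) : nat :=
  #|[set a : {set 'I_n} | `[< critical x a >] && (#|a| == k.+1)]|.

End Geometry.

Section Morse.
Context {R : realType} {n : nat}.
Implicit Types (s t a : {set 'I_n}) (K I : {set {set 'I_n}})
  (V : {set {set {set 'I_n}}}).

Definition full_complex : {set {set 'I_n}} := [set s : {set 'I_n} | s != set0].

Definition simplex_interval t s : {set {set 'I_n}} :=
  [set a : {set 'I_n} | (t \subset a) && (a \subset s)].

Definition interval_partition K V : Prop :=
  partition V K /\
  forall I, I \in V -> exists t s, t \subset s /\ I = simplex_interval t s.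

Definition discrete_gradient K (f : {set 'I_n} -> R) V : Prop :=
  [/\ interval_partition K V,
      forall t s, t \in K -> s \in K -> t \subset s -> f t <= f s
    & forall t s, t \in K -> s \in K -> t \subset s ->
        (f t = f s <-> exists I, [/\ I \in V, t \in I & s \in I])].

Definition vertex_interval I : Prop := exists v : 'I_n, I = [set [set v]].

Definition distinct_interval_births (f : {set 'I_n} -> R) V : Prop :=
  forall I J, I \in V -> J \in V -> I <> J ->
    ~ vertex_interval I -> ~ vertex_interval J ->
    forall a b, a \in I -> b \in J -> f a <> f b.

End Morse.

(* Simplices are oriented by the order of 'I_n. *)
Section Homology.
Context (F : fieldType) {n : nat}.
Implicit Types (s : {set 'I_n}) (K L : {set {set 'I_n}}) (q : nat).

Notation chain := {ffun {set 'I_n} -> F^o}.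

Definition simplex_chain s : chain := [ffun a => (a == s)%:R].

(* Unreduced: vertices have zero boundary. *)
Definition simplex_boundary s : chain :=
  if (1 < #|s|)%N then
    \sum_(v in s) (-1) ^+ #|[set w in s | (w < v)%N]| *: simplex_chain (s :\ v)
  else 0.

Definition boundary (c : chain) : chain := \sum_s c s *: simplex_boundary s.

Fact boundary_is_linear : linear boundary.
Proof.
move=> k c d; rewrite /boundary scaler_sumr -big_split /=.
by apply: eq_bigr => s _; rewrite !ffunE scalerDl scalerA.
Qed.

HB.instance Definition _ :=
  GRing.isLinear.Build F chain chain _ boundary boundary_is_linear.

Definition chains q K : {vspace chain} :=
  <<[seq simplex_chain s | s <- enum K & #|s| == q.+1]>>%VS.

Definition cycles q K : {vspace chain} :=
  (chains q K :&: lker (linfun boundary))%VS.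

Definition boundaries q K : {vspace chain} :=
  (linfun boundary @: chains q.+1 K)%VS.

(* For K \subset L, the dimension of Z_q(K) / (Z_q(K) :&: B_q(L)), i.e., of the
   image of H_q(K) -> H_q(L). *)
Definition persistent_betti q K L : nat :=
  (\dim (cycles q K) - \dim (cycles q K :&: boundaries q L))%N.

End Homology.

Section Diagram.
Context (F : fieldType) {R : realType} {N n : nat} (x : 'I_n -> 'rV[R]_N).

Definition births : seq R :=
  sort <=%R (undup [seq birth_time x s | s <- enum (@full_complex n)]).

(* With a_1 < ... < a_m the values of the birth time function, K_0 is empty and
   K_i is the Cech complex at a_i; since the balls are closed, the filtration is
   constant, equal to K_i, on [a_i, a_i.+1[ and to K_m on [a_m, +oo[. *)
Definition birth_value (i : nat) : R := nth 0 births i.-1.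

Definition stage (i : nat) : {set {set 'I_n}} :=
  if i is 0%N then set0 else cech x (birth_value i).

Definition beta (q i j : nat) : nat :=
  persistent_betti F q (stage i) (stage j).

(* Number of classes born at K_i that die entering K_j, for 0 < i < j. The
   differences are nonnegative, so truncation plays no role. *)
Definition multiplicity (q i j : nat) : nat :=
  ((beta q i j.-1 - beta q i j) - (beta q i.-1 j.-1 - beta q i.-1 j))%N.

Definition multiplicity_infty (q i : nat) : nat :=
  (beta q i (size births) - beta q i.-1 (size births))%N.

Definition persistence_diagram (q : nat) : seq (R * \bar R) :=
  let m := size births in
  flatten [seq nseq (multiplicity q i j) (birth_value i, (birth_value j)%:E)
          | i <- iota 1 m, j <- iota i.+1 (m - i)]
  ++ flatten [seq nseq (multiplicity_infty q i) (birth_value i, +oo%E)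
             | i <- iota 1 m].

End Diagram.

(* Main.v *)
Require Import Defs.
From HB Require Import structures.
From mathcomp Require Import boolp classical_sets reals constructive_ereal.
From mathcomp Require Import all_boot all_order all_algebra.
From mathcomp Require Import topology normedtype derive realfun.
From mathcomp Require Import zify.
Set Implicit Arguments.
Unset Strict Implicit.
Unset Printing Implicit Defensive.
Import Order.TTheory GRing.Theory Num.Theory.
Import numFieldNormedType.Exports.
Local Open Scope ring_scope.

(** Order the distinct birth times 0 = a_1 < ... < a_m and let K_i be the Čech
complex at a_i, so that K_1 is the set of vertices and K_m is the full simplex.

Since the multiplicities telescope, the number of points of the q-th diagram is
the number of classes born along the filtration, that is, the sum over i of the
dimensions of the cokernels of H_q(K_i) -> H_q(K_(i+1)), plus dim H_q(K_1)
([size_barcode]).  For a pair L included in K, let p_q and d_q be the dimensions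
of the cokernel and of the kernel of H_q(L) -> H_q(K).  The long exact sequence
of the pair gives
    p_(q+1) + d_q = dim H_(q+1)(K, L)
([relative_exactness], with the relative homology written out as a number of
simplices minus two ranks).

Because different non-vertex intervals have different birth times, each K_(i+1)
with i > 0 is obtained from K_i by adding one interval [t, s] of simplices ([stage_step]).
If t = s, this is a critical simplex, whose boundary already lies in K_i, so the
relative homology has dimension one, in the dimension of that simplex.  If t is
a proper subset of s, a vertex v of s outside t matches each added simplex a
without v with v |: a, so the relative homology vanishes ([matched_born_dying]).
Writing P_q and D_q for the sums of p_q and d_q over these steps, one gets
    P_(q+1) + D_q = N_(q+1),        P_0 = 0.

Rank-nullity along the filtration gives P_q - D_q = dim H_q(K_m) - dim H_q(K_1).
The full simplex is a cone, hence has the homology of a point (the matching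
argument again, relative to one vertex), and K_1 has homology only in degree 0,
of dimension n.  So D_0 = n - 1 and D_q = P_q for q > 0, and therefore
    P_1 = N_1 - (n - 1),            P_(q+1) = N_(q+1) - P_q,
which unfolds to the alternating sum ([born_sum_alternating]).

The geometric input is that the birth time is attained: by compactness, s has a
center minimizing the largest distance to the points of s, so that s belongs to
the complex at time t exactly when its birth time is at most t ([mem_cech]). *)

(** * Simplicial chains and their dimensions *)

Lemma dimv_cap_supermodular (F : fieldType) (T : vectType F) (Z Z' B B' : {vspace T}) :
  (Z' <= Z)%VS -> (B' <= B)%VS ->
  (\dim (Z' :&: B) + \dim (Z :&: B') <= \dim (Z' :&: B') + \dim (Z :&: B))%N.
Proof.
move=> ZZ BB; rewrite -[leqLHS]dimv_sum_cap addnC leq_add //; apply: dimvS.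
  rewrite subv_cap (subv_trans (capvSl _ _) (capvSl _ _)).
  exact: subv_trans (capvSr _ _) (capvSr _ _).
by rewrite subv_add !capvS.
Qed.

Section ChainComplex.
Context (F : fieldType) {n : nat}.
Implicit Types (s a : {set 'I_n}) (S K L : {set {set 'I_n}}) (q : nat).
Local Notation chain := {ffun {set 'I_n} -> F^o}.
Local Notation simplex_chain := (@simplex_chain F n).
Local Notation simplex_boundary := (@simplex_boundary F n).
Local Notation boundary := (@boundary F n).
Local Notation chains := (@chains F n).
Local Notation cycles := (@cycles F n).
Local Notation boundaries := (@boundaries F n).

Definition simplices q K : {set {set 'I_n}} := [set s in K | #|s| == q.+1].

Definition restrict S (c : chain) : chain := [ffun s => if s \in S then c s else 0].

Fact restrict_is_linear S : linear (restrict S).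
Proof.
move=> k c d; apply/ffunP => s; rewrite !ffunE.
by case: ifP => // _; rewrite scaler0 addr0.
Qed.

HB.instance Definition _ S :=
  GRing.isLinear.Build F chain chain _ (restrict S) (restrict_is_linear S).

(** Chains supported on an arbitrary set of simplices, of mixed dimensions; both
the chain spaces and the targets of projections have this form. *)
Definition chain_span S : {vspace chain} := <<[seq simplex_chain s | s in S]>>%VS.

Lemma chain_sum (c : chain) : c = \sum_s c s *: simplex_chain s.
Proof.
apply/ffunP => a; rewrite sum_ffunE (bigD1 a) //= big1 => [|s ns].
  by rewrite !ffunE eqxx addr0; apply/esym/mulr1.
by rewrite !ffunE eq_sym (negbTE ns); apply: mulr0.
Qed.

Lemma restrict_simplex S s :
  restrict S (simplex_chain s) = if s \in S then simplex_chain s else 0.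
Proof.
apply/ffunP => a; rewrite !ffunE; have [->|ns] := eqVneq a s.
  by case: ifP; rewrite !ffunE ?eqxx.
by case: ifP; case: ifP; rewrite !ffunE ?(negbTE ns).
Qed.

Lemma mem_chain_span S (c : chain) :
  reflect (forall s, s \notin S -> c s = 0) (c \in chain_span S).
Proof.
apply: (iffP idP) => [cS s Ss|cS].
  have /subvP/(_ _ cS) : (chain_span S <= lker (linfun (restrict (~: S))))%VS.
    apply/span_subvP => _ /imageP[a Sa ->].
    by rewrite memv_ker lfunE /= restrict_simplex inE Sa.
  rewrite memv_ker lfunE /= => /eqP/ffunP/(_ s).
  by rewrite !ffunE inE Ss.
rewrite (chain_sum c); apply: memv_suml => s _.
have [Ss|/cS->] := boolP (s \in S); last by rewrite scale0r mem0v.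
by apply/memvZ/memv_span/imageP; exists s.
Qed.

Lemma simplex_chain_in S s : s \in S -> simplex_chain s \in chain_span S.
Proof. by move=> Ss; apply/memv_span/imageP; exists s. Qed.

Lemma sub_chain_span S S' :
  S \subset S' -> (chain_span S <= chain_span S')%VS.
Proof.
move=> sub; apply/span_subvP => _ /imageP[a Sa ->].
exact/simplex_chain_in/(subsetP sub).
Qed.

Lemma dim_chain_span S : \dim (chain_span S) = #|S|.
Proof.
rewrite -(size_image simplex_chain S); apply/eqP; rewrite /chain_span.
pose X := [tuple of [seq simplex_chain s | s in S]].
(* Freeness is stated for tuples; evaluating a relation at a simplex isolates
   the corresponding coefficient. *)
suff : free X by [].
apply/freeP => k kX i; move/ffunP: kX => /(_ (enum_val i)).
rewrite sum_ffunE (bigD1 i) //= big1 => [|j ji].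
  rewrite (nth_map set0) -?cardE // !ffunE -(enum_val_nth set0) eqxx addr0 => <-.
  by apply/esym/mulr1.
rewrite (nth_map set0) -?cardE // !ffunE -(enum_val_nth set0).
by rewrite (inj_eq enum_val_inj) eq_sym (negbTE ji); apply: mulr0.
Qed.

Lemma chainsE q K : chains q K = chain_span (simplices q K).
Proof.
apply: eq_span => c; apply/mapP/imageP => [[s]|[s]].
  rewrite mem_filter mem_enum => /andP[qs Ks] ->.
  by exists s; rewrite // inE Ks.
by rewrite inE => /andP[Ks qs] ->; exists s; rewrite // mem_filter qs mem_enum.
Qed.

Lemma boundary_simplex s : boundary (simplex_chain s) = simplex_boundary s.
Proof.
rewrite /boundary (bigD1 s) //= big1 => [|a ns].
  by rewrite ffunE eqxx scale1r addr0.
by rewrite ffunE (negbTE ns) scale0r.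
Qed.

Lemma simplex_boundary_face s v : (1 < #|s|)%N -> v \in s ->
  simplex_boundary s (s :\ v) = (-1) ^+ #|[set w in s | (w < v)%N]|.
Proof.
move=> s1 sv; rewrite /simplex_boundary s1 sum_ffunE (bigD1 v) //=.
rewrite big1 => [|w /andP[sw wv]].
  by rewrite !ffunE eqxx addr0; apply: mulr1.
rewrite !ffunE; case: eqP => [/setP/(_ w)|_]; last exact: mulr0.
by rewrite !inE wv sw eqxx.
Qed.

Lemma simplex_boundary_nonface s a :
  (forall v, v \in s -> a != s :\ v) -> simplex_boundary s a = 0.
Proof.
move=> nf; rewrite /simplex_boundary; case: ifP => _; last by rewrite ffunE.
rewrite sum_ffunE big1 // => v sv; rewrite !ffunE (negbTE (nf v sv)).
exact: mulr0.
Qed.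

(** Removing v then w and removing w then v give the same face, and the sign of
the larger of the two vertices changes when the smaller one is removed first.
The terms are therefore cancelled in pairs w < v, which is valid in every
characteristic. *)
Lemma boundary_boundary (c : chain) : boundary (boundary c) = 0.
Proof.
rewrite {2}/boundary linear_sum big1 // => s _; rewrite linearZ /=.
suff -> : boundary (simplex_boundary s) = 0 by rewrite scaler0.
rewrite /simplex_boundary; case: ifP => [s1|_]; last exact: linear0.
rewrite linear_sum /=.
under eq_bigr do rewrite linearZ /= boundary_simplex.
have [s2|s2] := leqP #|s| 2.
  rewrite big1 // => v sv; rewrite /simplex_boundary ifN ?scaler0 //.
  by move: s2; rewrite (cardsD1 v s) sv -leqNgt.
have E v : v \in s -> simplex_boundary (s :\ v) =
    \sum_(w in s | w != v)
      (-1) ^+ #|[set u in s :\ v | (u < w)%N]| *: simplex_chain (s :\ v :\ w).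
  move=> sv; rewrite /simplex_boundary ifT; last first.
    by move: s2; rewrite (cardsD1 v s) sv.
  by apply: eq_bigl => w; rewrite !inE andbC.
under eq_bigr => v sv do rewrite (E v sv) scaler_sumr.
(* G v w is the term of the double sum that removes v first, then w. *)
pose G (v w : 'I_n) : chain := (-1) ^+ #|[set u in s | (u < v)%N]| *:
  ((-1) ^+ #|[set u in s :\ v | (u < w)%N]| *: simplex_chain (s :\ v :\ w)).
have GN (v w : 'I_n) : v \in s -> w \in s -> (w < v)%N -> G v w = - G w v.
  move=> sv sw wv; rewrite /G !scalerA -!exprD -scaleNr.
  have -> : s :\ v :\ w = s :\ w :\ v by rewrite !setDDl setUC.
  have -> : [set u in s :\ v | (u < w)%N] = [set u in s | (u < w)%N].
    apply/setP => u; rewrite !inE; case: eqVneq => // ->.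
    by rewrite [(v < w)%N]ltnNge (ltnW wv) /= andbF.
  rewrite (cardsD1 w [set u in s | (u < v)%N]) inE sw wv /=.
  have -> : [set u in s | (u < v)%N] :\ w = [set u in s :\ w | (u < v)%N].
    by apply/setP => u; rewrite !inE andbA.
  by rewrite -addnA add1n exprS mulN1r addnC.
rewrite (eq_bigr (fun v : 'I_n => \sum_(w in s | (w < v)%N) G v w
                         + \sum_(w in s | (v < w)%N) G v w)); last first.
  move=> v sv; rewrite (bigID (fun w : 'I_n => (w < v)%N)) /=; congr (_ + _).
    by apply: eq_bigl => w; rewrite -andbA ltn_neqAle val_eqE; case: (w != v).
  by apply: eq_bigl => w; rewrite -andbA -leqNgt ltn_neqAle val_eqE eq_sym.
rewrite big_split /= [X in _ + X](exchange_big_dep (mem s)) /=;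
  last by move=> v w _ /andP[].
rewrite -big_split big1 //= => v sv.
rewrite [X in _ + X](eq_bigl (fun w => (w \in s) && (w < v)%N)); last first.
  by move=> w; rewrite sv.
rewrite -big_split big1 //= => w /andP[sw wv].
by rewrite GN // addNr.
Qed.

Definition simplicial_complex K : Prop :=
  forall s a, s \in K -> a \subset s -> a != set0 -> a \in K.

Lemma sub_simplices q K L : L \subset K -> simplices q L \subset simplices q K.
Proof.
move=> LK; apply/subsetP => s; rewrite !inE => /andP[/(subsetP LK)-> ->//].
Qed.

Lemma sub_chains q K L : L \subset K -> (chains q L <= chains q K)%VS.
Proof. by move=> LK; rewrite !chainsE sub_chain_span ?sub_simplices. Qed.

Lemma sub_cycles q K L : L \subset K -> (cycles q L <= cycles q K)%VS.
Proof. by move=> LK; apply/capvS => //; apply: sub_chains. Qed.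

Lemma sub_boundaries q K L : L \subset K -> (boundaries q L <= boundaries q K)%VS.
Proof. by move=> LK; apply/limgS/sub_chains. Qed.

(** A bound on a boundary space need only be checked on simplices. *)
Lemma boundaries_span q K (U : {vspace chain}) :
  (forall s, s \in simplices q.+1 K -> simplex_boundary s \in U) ->
  (boundaries q K <= U)%VS.
Proof.
move=> sU; rewrite /boundaries chainsE limg_span; apply/span_subvP.
move=> _ /mapP[_ /imageP[s Ks ->] ->].
by rewrite lfunE /= boundary_simplex sU.
Qed.

Lemma simplex_boundary_in_boundaries q K s :
  s \in simplices q.+1 K -> simplex_boundary s \in boundaries q K.
Proof.
move=> Ks; rewrite -boundary_simplex -[boundary _]lfunE memv_img //.
by rewrite chainsE simplex_chain_in.
Qed.

Lemma simplex_boundary_cycle q K s :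
  #|s| = q.+2 -> (forall v, v \in s -> s :\ v \in K) ->
  simplex_boundary s \in cycles q K.
Proof.
move=> qs faces; rewrite memv_cap memv_ker lfunE /= -boundary_simplex.
rewrite boundary_boundary eqxx andbT boundary_simplex chainsE.
apply/mem_chain_span => a Ka; apply: simplex_boundary_nonface => v sv.
apply: contraNneq Ka => ->; rewrite inE faces //.
by move: qs; rewrite (cardsD1 v) sv add1n => -[->]; rewrite eqxx.
Qed.

Lemma face_in_complex K s v : simplicial_complex K ->
  s \in K -> (1 < #|s|)%N -> v \in s -> s :\ v \in K.
Proof.
move=> cK Ks s1 sv; apply: (cK s) => //; first exact: subD1set.
by rewrite -card_gt0; move: s1; rewrite (cardsD1 v) sv.
Qed.

Lemma boundaries_sub_cycles q K :
  simplicial_complex K -> (boundaries q K <= cycles q K)%VS.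
Proof.
move=> cK; apply: boundaries_span => s; rewrite inE => /andP[Ks /eqP qs].
by apply: simplex_boundary_cycle => // v sv; apply: face_in_complex; rewrite ?qs.
Qed.

Lemma dim_chains q K : \dim (chains q K) = #|simplices q K|.
Proof. by rewrite chainsE dim_chain_span. Qed.

Lemma dim_cycles_boundaries q K :
  (\dim (cycles q.+1 K) + \dim (boundaries q K) = #|simplices q.+1 K|)%N.
Proof. by rewrite limg_ker_dim dim_chains. Qed.

Lemma cycles0 K : cycles 0 K = chains 0 K.
Proof.
apply/capv_idPl; rewrite chainsE; apply/span_subvP => _ /imageP[s + ->].
rewrite inE memv_ker lfunE /= boundary_simplex /simplex_boundary.
by case/andP=> _ /eqP ->.
Qed.

Local Notation persistent_betti := (@persistent_betti F n).

(** The dimension of the cokernel of H_q(L) -> H_q(K). *)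
Definition born q L K : nat :=
  (persistent_betti q K K - persistent_betti q L K)%N.

(** The dimension of the kernel of H_q(L) -> H_q(K). *)
Definition dying q L K : nat :=
  (persistent_betti q L L - persistent_betti q L K)%N.

(** The rank of the relative boundary map C_(q+1)(K, L) -> C_q(K, L): a boundary
of K vanishes in C_q(K, L) exactly when it is a chain, hence a cycle, of L. *)
Definition relative_boundary_rank q L K : nat :=
  (\dim (boundaries q K) - \dim (cycles q L :&: boundaries q K))%N.

Definition toggle (v : 'I_n) s : {set 'I_n} :=
  if v \in s then s :\ v else v |: s.

Lemma toggleK v : involutive (toggle v).
Proof.
move=> s; rewrite {2}/toggle; case: ifPn => vs; rewrite /toggle.
  by rewrite !inE eqxx /= setD1K.
by rewrite setU11 setU1K.
Qed.

Section Pair.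
Variables (K L : {set {set 'I_n}}).
Hypotheses (cK : simplicial_complex K) (cL : simplicial_complex L).
Hypothesis LK : L \subset K.

(** The inequalities that make all truncated differences exact. *)
Lemma pair_dimensions q :
  [/\ (\dim (boundaries q L) <= \dim (cycles q L :&: boundaries q K))%N,
      (\dim (cycles q L :&: boundaries q K) <= \dim (cycles q L))%N,
      (\dim (cycles q L :&: boundaries q K) <= \dim (boundaries q K))%N
    & (\dim (cycles q L) + \dim (boundaries q K) <=
       \dim (cycles q K) + \dim (cycles q L :&: boundaries q K))%N].
Proof.
split; try by rewrite dimvS ?capvSl ?capvSr.
  by rewrite dimvS // subv_cap boundaries_sub_cycles ?sub_boundaries.
rewrite -[leqLHS]dimv_sum_cap leq_add2r dimvS // subv_add sub_cycles //.
exact: boundaries_sub_cycles.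
Qed.

Lemma persistent_betti_diag q K' : simplicial_complex K' ->
  persistent_betti q K' K' = (\dim (cycles q K') - \dim (boundaries q K'))%N.
Proof.
by move=> cK'; rewrite /persistent_betti (capv_idPr (boundaries_sub_cycles _ cK')).
Qed.

Lemma persistent_betti_le q :
  (persistent_betti q L K <= persistent_betti q K K)%N /\
  (persistent_betti q L K <= persistent_betti q L L)%N.
Proof.
rewrite !persistent_betti_diag // /persistent_betti.
by have [*] := pair_dimensions q; split; lia.
Qed.

Lemma card_simplices_diff q :
  (#|simplices q (K :\: L)| + #|simplices q L| = #|simplices q K|)%N.
Proof.
rewrite -(cardsID L (simplices q K)) addnC; congr (_ + _)%N; apply: eq_card => s.
  by rewrite !inE; case: (boolP (s \in L)) => [/(subsetP LK)->|]; rewrite ?andbF ?andbT.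
by rewrite !inE andbA.
Qed.

(** The long exact sequence of the pair (K, L): the number of (q+1)-simplices of
K outside L, minus the ranks of the relative boundary maps leaving and entering
degree q + 1, is the dimension of H_(q+1)(K, L).  On dimensions it amounts to
rank-nullity for the boundary maps of K and of L. *)
Lemma relative_exactness q :
  (born q.+1 L K + dying q L K +
   relative_boundary_rank q L K + relative_boundary_rank q.+1 L K =
   #|simplices q.+1 (K :\: L)|)%N.
Proof.
have EK := dim_cycles_boundaries q K; have EL := dim_cycles_boundaries q L.
have := card_simplices_diff q.+1; have := pair_dimensions q.
have := pair_dimensions q.+1.
rewrite /born /dying /relative_boundary_rank !persistent_betti_diag // /persistent_betti.
by case=> ? ? ? ? [*]; lia.
Qed.

(** The same in degree 0, where no boundary map leaves. *)
Lemma relative_exactness0 :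
  (born 0 L K + relative_boundary_rank 0 L K = #|simplices 0 (K :\: L)|)%N.
Proof.
have := card_simplices_diff 0; have := pair_dimensions 0.
rewrite /born /relative_boundary_rank !persistent_betti_diag // /persistent_betti.
rewrite !cycles0 !dim_chains; case=> ? ? ? ?; lia.
Qed.

(** All proper faces of a simplex of K lie in L: this holds for those of [a], the
only new simplex, and [a] is not a proper face of a simplex of L. *)
Lemma relative_boundary_rank_simplex a q : K = a |: L -> a \notin L ->
  relative_boundary_rank q L K = 0%N.
Proof.
move=> Ka La; apply/eqP; rewrite subn_eq0 dimvS // subv_cap subvv andbT.
apply: boundaries_span => s; rewrite inE => /andP[Ks /eqP qs].
apply: simplex_boundary_cycle => // v sv.
have: s :\ v \in K by apply: face_in_complex; rewrite ?qs.
rewrite Ka in_setU1 => /orP[/eqP sva|//].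
move: Ks; rewrite Ka in_setU1 => /orP[/eqP sa|Ls].
  by move/setP/(_ v): sva; rewrite -sa !inE sv eqxx.
by apply: face_in_complex; rewrite ?qs.
Qed.

(** The chain boundary of v |: s has coefficient 1 or -1 on s, and s is its only
face that avoids v.  So the boundaries of the v |: s, for s new and without v,
stay independent after projection to the new simplices without v, while all
chains of L are projected to 0. *)
Lemma relative_boundary_rank_matching v q :
  (forall s, (toggle v s \in K :\: L) = (s \in K :\: L)) ->
  (#|[set s in simplices q (K :\: L) | v \notin s]| <=
   relative_boundary_rank q L K)%N.
Proof.
move=> tog; set W := [set s in _ | _].
have dimB := limg_ker_dim (linfun (restrict W)) (boundaries q K).
have le1 : (\dim (cycles q L :&: boundaries q K) <=
    \dim (boundaries q K :&: lker (linfun (restrict W))))%N.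
  rewrite dimvS // subv_cap capvSr /=; apply: (subv_trans (capvSl _ _)).
  apply: (subv_trans (capvSl _ _)); rewrite chainsE; apply/span_subvP.
  move=> _ /imageP[s + ->]; rewrite inE => /andP[Ls _].
  by rewrite memv_ker lfunE /= restrict_simplex !inE Ls.
suff : (#|W| <= \dim (linfun (restrict W) @: boundaries q K))%N.
  move=> le2; rewrite /relative_boundary_rank -dimB; apply: leq_trans le2 _.
  by rewrite leq_subRL ?leq_add2r // (leq_trans le1) ?leq_addr.
rewrite -dim_chain_span dimvS //; apply/span_subvP => _ /imageP[s Ws ->].
have := Ws; rewrite inE => /andP[]; rewrite inE => /andP[KLs /eqP qs] vs.
have Kvs : v |: s \in K.
  by move: (tog s); rewrite /toggle (negbTE vs) KLs => /setDP[].
have qvs : #|v |: s| = q.+2 by rewrite cardsU1 vs qs.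
(* The projection keeps only the face s of v |: s. *)
have bs : restrict W (simplex_boundary (v |: s)) =
    simplex_boundary (v |: s) s *: simplex_chain s.
  apply/ffunP => a; rewrite !ffunE; case: (eqVneq a s) => [->|as_].
    by rewrite Ws; apply/esym/mulr1.
  rewrite [RHS]mulr0; case: ifP => // Wa; apply: simplex_boundary_nonface => w.
  rewrite in_setU1 => /orP[/eqP ->|sw].
    by rewrite setU1K.
  apply/eqP => /setP/(_ v); rewrite !inE eqxx /=.
  have -> : (v \in a) = false by apply/negbTE; move: Wa; rewrite inE => /andP[].
  by rewrite andbT => /esym/negbFE/eqP vw; rewrite vw sw in vs.
have : restrict W (simplex_boundary (v |: s)) \in (linfun (restrict W) @: boundaries q K)%VS.
  rewrite -[restrict _ _]lfunE memv_img // simplex_boundary_in_boundaries //.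
  by rewrite inE Kvs qvs eqxx.
have vs1 : (1 < #|v |: s|)%N by rewrite qvs.
have := simplex_boundary_face vs1 (setU11 v s); rewrite setU1K // => face.
rewrite bs face => /(memvZ ((-1) ^+ #|[set w in v |: s | (w < v)%N]|)).
by rewrite scalerA -exprD addnn -signr_odd odd_double scale1r.
Qed.

(** A set of new simplices matched by toggling one vertex carries no relative
homology.  Let w_i be the number of new i-simplices without v; the matching
gives w_i + w_(i+1) new simplices in dimension i + 1, and the relative boundary
maps already have ranks at least w_i and w_(i+1), so the exact sequence leaves
0 for the classes born in degree i + 1 and dying in degree i. *)
Lemma matched_born_dying v :
  (forall s, (toggle v s \in K :\: L) = (s \in K :\: L)) ->
  set0 \notin K ->
  forall q, born q L K = 0%N /\ dying q L K = 0%N.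
Proof.
move=> tog K0 q.
pose w i := #|[set s in simplices i (K :\: L) | v \notin s]|.
have rank i : (w i <= relative_boundary_rank i L K)%N.
  exact: relative_boundary_rank_matching.
have simpS i : #|simplices i.+1 (K :\: L)| = (w i + w i.+1)%N.
  rewrite -(cardsID [set s : {set 'I_n} | v \in s]); congr (_ + _)%N; last first.
    by apply: eq_card => s; rewrite !inE andbC.
  rewrite /w -[RHS](card_imset _ (can_inj (toggleK v))); apply: eq_card => s.
  apply/setIP/imsetP => [[]|[a]].
    rewrite !inE -in_setD => /andP[KLs qs] vs.
    exists (toggle v s); last by rewrite toggleK.
    rewrite inE inE tog KLs /toggle vs setD11 andbT /=.
    by move: qs; rewrite (cardsD1 v) vs.
  case/setIdP => /setIdP[KLa /eqP qa] va ->.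
  by rewrite !inE -!in_setD tog KLa /toggle (negbTE va) setU11 cardsU1 va qa eqxx.
have simp0 : #|simplices 0 (K :\: L)| = w 0%N.
  apply: eq_card => s; rewrite [RHS]inE inE; case KLs: (s \in _) => //=.
  case: (boolP (#|s| == 1%N)) => //= /cards1P[u us]; apply/esym.
  apply: contraNN K0 => vs; have := tog s; rewrite KLs /toggle vs => /setDP[+ _].
  suff -> : s :\ v = set0 by [].
  by move: vs; rewrite us inE => /eqP <-; apply: setDv.
have LES i : born i.+1 L K = 0%N /\ dying i L K = 0%N.
  have := relative_exactness i; have := rank i; have := rank i.+1.
  by rewrite simpS; lia.
split; last by case: (LES q).
case: q => [|q]; last by case: (LES q).
by have := relative_exactness0; have := rank 0%N; rewrite simp0; lia.
Qed.

End Pair.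

End ChainComplex.

(** * Elementary steps and filtrations of complexes *)

Section Pairs.
Context (F : fieldType) {n : nat}.
Implicit Types (K L : {set {set 'I_n}}) (q : nat).
Local Notation persistent_betti := (@persistent_betti F n).
Local Notation born := (@born F n).
Local Notation dying := (@dying F n).

(** At most one simplex satisfies the condition on K; this is stated as a set so
that the cells can be counted along a filtration. *)
Definition critical_cells q L K : {set {set 'I_n}} :=
  [set a in K :\: L | (K == a |: L) && (#|a| == q.+1)].

Lemma critical_step q L K a : simplicial_complex K -> simplicial_complex L ->
  K = a |: L -> a \notin L ->
  (born q.+1 L K + dying q L K)%N = #|critical_cells q.+1 L K|.
Proof.
move=> cK cL Ka La; have LK : L \subset K by rewrite Ka subsetUr.
have := relative_exactness F cK cL LK q.
rewrite !(relative_boundary_rank_simplex F cK cL _ Ka La) !addn0 => ->.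
apply: eq_card => s; rewrite !inE.
case: (boolP (s == a)) => [/eqP->|sa]; first by rewrite -Ka eqxx andTb.
by rewrite Ka in_setU1 (negbTE sa) /=; case: (s \in L).
Qed.

(** Toggling a vertex of s outside t preserves [t, s]; such an interval has at
least two simplices, so it contains no critical cell. *)
Lemma interval_step q L K (t s : {set 'I_n}) :
  simplicial_complex K -> simplicial_complex L -> L \subset K -> set0 \notin K ->
  K :\: L = simplex_interval t s -> t \proper s ->
  (born q.+1 L K + dying q L K)%N = #|critical_cells q.+1 L K|.
Proof.
move=> cK cL LK K0 KL /properP[ts [v sv tv]].
have tog a : (toggle v a \in K :\: L) = (a \in K :\: L).
  rewrite KL !inE /toggle; case: ifPn => va.
    rewrite subsetD1 tv andbT; congr (_ && _).
    by rewrite -[in RHS](setD1K va) subUset sub1set sv.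
  rewrite subUset sub1set sv; congr (_ && _).
  by rewrite -[in RHS](setU1K va) subsetD1 tv andbT.
have H := matched_born_dying F cK cL LK tog K0.
rewrite (H _).1 (H _).2; apply/esym/eqP; rewrite cards_eq0; apply/eqP/setP => a.
apply/negP; rewrite !inE => /andP[/andP[La Ka] /andP[/eqP KaL _]].
have := tog a; rewrite !inE La Ka {1}KaL in_setU1 andb_orr => /orP[/andP[_ /eqP]|].
  by rewrite /toggle; case: ifPn => va /setP/(_ v); rewrite !inE eqxx ?va ?(negbTE va).
by case: (_ \in L).
Qed.

Lemma persistent_betti_mono q L L' K : L \subset L' ->
  (persistent_betti q L K <= persistent_betti q L' K)%N.
Proof.
move=> LL.
have := dimv_cap_supermodular (sub_cycles F q LL) (subvf (boundaries F q K)).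
rewrite !capvf /persistent_betti.
have := dimvS (capvSl (cycles F q L) (boundaries F q K)); lia.
Qed.

Lemma persistent_betti_anti q L K K' : K \subset K' ->
  (persistent_betti q L K' <= persistent_betti q L K)%N.
Proof.
by move=> KK; rewrite leq_sub2l // dimvS // capvS // sub_boundaries.
Qed.

(** Classes of L that die between K and K' also die as classes of the larger L'.
This is what makes the multiplicities of a persistence diagram nonnegative. *)
Lemma persistent_betti_mixed q L L' K K' : L \subset L' -> K \subset K' ->
  (persistent_betti q L K - persistent_betti q L K' <=
   persistent_betti q L' K - persistent_betti q L' K')%N.
Proof.
move=> LL KK.
have := dimv_cap_supermodular (sub_cycles F q LL) (sub_boundaries F q KK).
rewrite /persistent_betti.
have := dimvS (capvSl (cycles F q L) (boundaries F q K)).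
have := dimvS (capvSl (cycles F q L') (boundaries F q K)).
have := dimvS (capvSl (cycles F q L) (boundaries F q K')).
have := dimvS (capvSl (cycles F q L') (boundaries F q K')).
lia.
Qed.

Lemma betti_dim0 q K' : simplices q K' = set0 -> persistent_betti q K' K' = 0%N.
Proof.
move=> K0; apply/eqP; rewrite subn_eq0 (leq_trans _ (leq0n _)) //.
by rewrite (leq_trans (dimvS (capvSl _ _))) // dim_chains K0 cards0.
Qed.

Definition vertices (A : {set 'I_n}) : {set {set 'I_n}} := [set [set v] | v in A].

Lemma simplices_vertices q A : simplices q.+1 (vertices A) = set0.
Proof.
apply/setP => s; rewrite !inE; apply/negP => /andP[/imsetP[v _ ->]].
by rewrite cards1.
Qed.

Lemma simplices0_vertices A : simplices 0 (vertices A) = vertices A.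
Proof.
apply/setP => s; rewrite inE; apply: andb_idr => /imsetP[v _ ->].
by rewrite cards1.
Qed.

Lemma betti_vertices q A :
  persistent_betti q (vertices A) (vertices A) = (if q == 0 then #|A| else 0)%N.
Proof.
case: q => [|q]; last by rewrite betti_dim0 ?simplices_vertices.
rewrite /persistent_betti.
have -> : boundaries F 0 (vertices A) = 0%VS.
  by apply/eqP; rewrite -subv0; apply: boundaries_span => s; rewrite simplices_vertices inE.
rewrite capv0 dimv0 subn0 cycles0 dim_chains simplices0_vertices.
by rewrite card_imset //; apply: set1_inj.
Qed.

Lemma simplicial_full : simplicial_complex (@full_complex n).
Proof. by move=> s a _ _; rewrite inE. Qed.

Lemma simplicial_vertices A : simplicial_complex (vertices A).
Proof.
move=> _ a /imsetP[v Av ->]; rewrite subset1 => /orP[/eqP->|/eqP->].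
  by move=> _; apply/imsetP; exists v.
by rewrite eqxx.
Qed.

(** The full simplex is a cone with apex v: toggling v matches all the simplices
other than the apex itself, so its homology is that of a point. *)
Lemma betti_full q (v : 'I_n) :
  persistent_betti q full_complex full_complex = (q == 0)%N.
Proof.
have LK : vertices [set v] \subset full_complex.
  by apply/subsetP => _ /imsetP[w _ ->]; rewrite inE -card_gt0 cards1.
have inL s : (s \in vertices [set v]) = (s == [set v]).
  by rewrite /vertices imset_set1 inE.
have tog s : (toggle v s \in full_complex :\: vertices [set v]) =
             (s \in full_complex :\: vertices [set v]).
  have E a : (a \in full_complex :\: vertices [set v]) = (a :\ v != set0).
    rewrite in_setD inL inE setD_eq0 subset1.
    by rewrite negb_or.
  rewrite !E /toggle; case: ifPn => va; last first.
    by rewrite -[in RHS](setU1K va) setDDl setUid.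
  by rewrite setDDl setUid.
have full0 : set0 \notin @full_complex n by rewrite inE eqxx.
have [] := matched_born_dying F simplicial_full (@simplicial_vertices [set v]) LK tog full0 q.
have := persistent_betti_le F simplicial_full (@simplicial_vertices [set v]) LK q.
have := betti_vertices q [set v]; rewrite cards1 /born /dying.
case: (q == 0%N) => -> [] /=; lia.
Qed.

End Pairs.

Section Filtration.
Context (F : fieldType) {n : nat}.
Implicit Types (i j q : nat).
Local Notation persistent_betti := (@persistent_betti F n).
Local Notation born := (@born F n).
Local Notation dying := (@dying F n).
Variables (K : nat -> {set {set 'I_n}}) (m : nat).
Hypothesis cK : forall i, (i <= m)%N -> simplicial_complex (K i).
Hypothesis K_mono : forall i, (i < m)%N -> K i \subset K i.+1.

Lemma filtration_sub i j : (i <= j <= m)%N -> K i \subset K j.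
Proof.
case/andP; elim: j => [|j IHj]; first by rewrite leqn0 => /eqP->.
rewrite leq_eqVlt => /predU1P[->//|ij] jm.
by apply: subset_trans (K_mono jm); apply: IHj => //; apply: ltnW.
Qed.

(** The classes born at K_i either die at some later step or survive; summing the
multiplicities over the time of death telescopes. *)
Lemma sum_multiplicity q i l : (0 < i)%N -> (i + l <= m)%N ->
  let beta i j := persistent_betti q (K i) (K j) in
  (\sum_(j <- iota i.+1 l)
     ((beta i j.-1 - beta i j) - (beta i.-1 j.-1 - beta i.-1 j))
   + (beta i (i + l) - beta i.-1 (i + l)))%N = born q (K i.-1) (K i).
Proof.
move=> i0 + beta; elim: l => [|l IHl] ilm; first by rewrite addn0 big_nil.
rewrite -[l.+1]addn1 iotaD big_cat big_seq1 -IHl; last by lia.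
rewrite -!addnA; congr (_ + _)%N; rewrite addn1 addSn /= addnS.
have sub1 : K i.-1 \subset K i by apply: filtration_sub; lia.
have sub2 : K (i + l) \subset K (i + l).+1 by apply: filtration_sub; lia.
have := persistent_betti_mixed F q sub1 sub2.
have := persistent_betti_mono F q (K (i + l)) sub1.
have := persistent_betti_mono F q (K (i + l).+1) sub1.
have := persistent_betti_anti F q (K i) sub2.
have := persistent_betti_anti F q (K i.-1) sub2.
by rewrite /beta; lia.
Qed.

Lemma size_barcode q :
  let beta i j := persistent_betti q (K i) (K j) in
  (\sum_(i <- iota 1 m) \sum_(j <- iota i.+1 (m - i))
     ((beta i j.-1 - beta i j) - (beta i.-1 j.-1 - beta i.-1 j))
   + \sum_(i <- iota 1 m) (beta i m - beta i.-1 m))%N =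
  (\sum_(i <- iota 1 m) born q (K i.-1) (K i))%N.
Proof.
move=> beta; rewrite -big_split /=; apply: eq_big_seq => i.
rewrite mem_iota => /andP[i0 im].
rewrite -(sum_multiplicity q i0 (l := m - i)) ?subnKC //; lia.
Qed.

Hypothesis K_set0 : forall i, set0 \notin K i.
Hypothesis m_gt0 : (0 < m)%N.
Hypothesis K0 : K 0 = set0.
Hypothesis K1 : K 1 = vertices setT.
Hypothesis Km : K m = full_complex.
Hypothesis K_step : forall i, (0 < i < m)%N ->
  exists t s : {set 'I_n}, t \subset s /\ K i.+1 :\: K i = simplex_interval t s.

Let born_total q := (\sum_(1 <= i < m) born q (K i) (K i.+1))%N.
Let dying_total q := (\sum_(1 <= i < m) dying q (K i) (K i.+1))%N.

Lemma filtration_step q i : (0 < i < m)%N ->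
  (born q.+1 (K i) (K i.+1) + dying q (K i) (K i.+1))%N =
  #|critical_cells q.+1 (K i) (K i.+1)|.
Proof.
move=> /andP[i0 im]; have [t [s [ts E]]] := K_step (introT andP (conj i0 im)).
have [cKi cKi1] := (cK (ltnW im), cK im).
have [tps|] := boolP (t \proper s).
  exact: (interval_step F q cKi1 cKi (K_mono im) (K_set0 _) E tps).
rewrite properEneq ts andbT negbK => /eqP st; subst s.
have E1 : K i.+1 :\: K i = [set t].
  by rewrite E; apply/setP => a; rewrite !inE eqEsubset andbC.
apply: (critical_step F q cKi1 cKi (a := t)) => //.
  by rewrite -E1 setUC setDE setUIr setUCr setIT; apply/esym/setUidPr/K_mono.
by have := set11 t; rewrite -E1 => /setDP[].
Qed.

Lemma born_dying_total q :
  (born_total q.+1 + dying_total q)%N =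
  (\sum_(1 <= i < m) #|critical_cells q.+1 (K i) (K i.+1)|)%N.
Proof.
by rewrite -big_split; apply: eq_big_nat => i im; apply: filtration_step.
Qed.

(** Each step changes the Betti number by the classes born minus those dying; the
first complex has n components, the last one has the homology of a point. *)
Lemma betti_balance q (v : 'I_n) :
  ((q == 0) + dying_total q = (if q == 0 then n else 0) + born_total q)%N.
Proof.
rewrite -(betti_full F q v) -Km -{2}(card_ord n) -cardsT -(betti_vertices F) -K1.
rewrite /dying_total /born_total; move: (leqnn m) (m_gt0).
elim: {1 3 4 5 6 7}m => // j IHj jm _; have [->|j0] := posnP j.
  by rewrite !big_geq // !addn0.
have jltm : (j < m)%N by [].
rewrite !big_nat_recr //=; have := IHj (ltnW jm) j0.
have := persistent_betti_le F (cK jm) (cK (ltnW jltm)) (K_mono jltm) q.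
by rewrite /born /dying => -[]; lia.
Qed.

(** All vertices are present from the first complex on, so that no component can
appear later. *)
Lemma born_total0 : born_total 0 = 0%N.
Proof.
apply: big1_seq => i; rewrite mem_index_iota => /andP[_ /andP[i0 im]].
have := relative_exactness0 F (cK im) (cK (ltnW im)) (K_mono im).
suff -> : simplices 0 (K i.+1 :\: K i) = set0 by rewrite cards0; lia.
apply/setP => s; rewrite !inE; apply/negP => /andP[/andP[nKs _] /cards1P[v sv]].
have /subsetP : K 1 \subset K i by apply: filtration_sub; rewrite i0 ltnW.
move/(_ s)=> sub; case/negP: nKs; apply: sub.
by rewrite K1 sv; apply/imsetP; exists v.
Qed.

Lemma born_sum q :
  (\sum_(i <- iota 1 m) born q (K i.-1) (K i))%N =
  ((if q == 0 then n else 0) + born_total q)%N.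
Proof.
rewrite -{1}[m]prednK //= big_cons /= K0 K1 /born betti_vertices cardsT card_ord.
have -> : persistent_betti q set0 (vertices setT) = 0%N.
  apply/eqP; rewrite subn_eq0 (leq_trans _ (leq0n _)) //.
  rewrite (leq_trans (dimvS (capvSl _ _))) // dim_chains -(cards0 {set 'I_n}).
  by apply: subset_leq_card; apply/subsetP => s; rewrite !inE.
rewrite subn0; congr (_ + _)%N.
rewrite /born_total /index_iota subn1 -[2%N]/(1 + 1)%N iotaDl big_map.
by apply: eq_bigr => i _; rewrite add1n.
Qed.

(** Induction on the degree: the classes of degree q that are born after K_1 all
die, each by a critical simplex of dimension q + 1, and the other critical
(q+1)-simplices give birth to the classes of degree q + 1. *)
Lemma born_sum_alternating q (v : 'I_n) : (0 < q)%N ->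
  ((\sum_(i <- iota 1 m) born q (K i.-1) (K i))%N)%:Z =
  \sum_(1 <= k < q.+1) (-1) ^+ (q - k)%N *
    (\sum_(1 <= i < m) #|critical_cells k (K i) (K i.+1)|)%N%:Z
  + (-1) ^+ q * (n%:Z - 1).
Proof.
case: q => // q _; elim: q => [|q IHq].
  rewrite big_nat1 subnn expr0 mul1r expr1 mulN1r.
  rewrite -born_dying_total born_sum /=.
  have := betti_balance 0 v; rewrite born_total0 /=; lia.
rewrite big_nat_recr //= subnn expr0 mul1r -born_dying_total.
rewrite (eq_big_nat _ _ (F2 := fun k => - ((-1) ^+ (q.+1 - k)%N *
    (\sum_(1 <= i < m) #|critical_cells k (K i) (K i.+1)|)%N%:Z))); last first.
  by move=> k /andP[_ kq]; rewrite subSn // exprS -mulrA mulN1r.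
rewrite sumrN [in X in _ + X]exprS -mulrA mulN1r; move: IHq; rewrite !born_sum /=.
set T : int := \sum_(1 <= k < _) _; set U : int := _ * (n%:Z - 1).
have := betti_balance q.+1 v; rewrite /=.
move: T U => T U; lia.
Qed.

End Filtration.

(** * Birth times of Čech simplices *)

Lemma singleton_neq0 {n} (v : 'I_n) : [set v] != set0.
Proof. by apply/set0Pn; exists v; rewrite inE. Qed.

Section BirthTime.
Local Notation edist := Defs.edist.
Context {R : realType} {N n : nat}.
Variable x : 'I_n -> 'rV[R]_N.
Implicit Types (s a : {set 'I_n}) (y : 'rV[R]_N) (t : R).

Lemma edist_ge0 (u v : 'rV[R]_N) : 0 <= edist u v.
Proof. exact: sqrtr_ge0. Qed.

Lemma ler_coord_edist (u v : 'rV[R]_N) j : `|u 0 j - v 0 j| <= edist u v.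
Proof.
rewrite -sqrtr_sqr ler_wsqrtr // (bigD1 j) //= lerDl.
by apply: sumr_ge0 => k _; apply: sqr_ge0.
Qed.

Lemma edist_eq0 (u v : 'rV[R]_N) : edist u v <= 0 -> u = v.
Proof.
move=> uv; apply/rowP => j; apply/eqP; rewrite -subr_eq0 -normr_le0.
exact: le_trans (ler_coord_edist _ _ _) uv.
Qed.

Lemma edist_refl (u : 'rV[R]_N) : edist u u = 0.
Proof.
by rewrite /edist big1 ?sqrtr0 // => j _; rewrite subrr expr0n.
Qed.

Lemma edist_continuous (c : 'rV[R]_N) : continuous (fun y => edist y c).
Proof.
move=> y; apply: (@continuous_comp _ _ _ (fun y => \sum_j (y 0 j - c 0 j) ^+ 2)
  Num.sqrt); last exact: sqrt_continuous.
apply: (cvg_big (@add_continuous R)) => [|j _]; first exact: nbhs_filter.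
apply: (@continuous_comp _ _ _ (fun y : 'rV[R]_N => y 0 j - c 0 j) (fun r => r ^+ 2));
  last exact: exprn_continuous.
apply: cvgB; first exact: (nbhs_filter y); last exact: (@cst_continuous _ _ (c 0 j) y).
exact: (@coord_continuous R 1 N 0 j y).
Qed.

(** The balls of radius t around the points of s meet at y exactly when the ball
of radius t around y contains these points; [radius s y] is the least such t. *)
Definition radius s y : R := \big[Num.max/0]_(i in s) edist y (x i).

Lemma radius_continuous s : continuous (radius s).
Proof.
move=> y; apply: (cvg_big (@max_continuous _ R)) => [|i _]; first exact: nbhs_filter.
exact: edist_continuous.
Qed.

Lemma radius_leP s y t :
  reflect (0 <= t /\ forall i, i \in s -> edist y (x i) <= t) (radius s y <= t).
Proof. exact: (iffP (bigmax_leP _ _ _ _)). Qed.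

Lemma mem_cech_radius s t :
  s \in cech x t <-> s != set0 /\ exists y, radius s y <= t.
Proof.
rewrite inE; split => [/andP[s0 /asboolP[y ys]]|[s0 [y /radius_leP[_ ys]]]].
  split=> //; exists y; apply/radius_leP; split=> //.
  have /set0Pn[i si] := s0.
  exact: le_trans (edist_ge0 _ _) (ys i si).
by rewrite s0; apply/asboolP; exists y.
Qed.

(** The points y whose radius is at most that of the origin form a subset of a
compact ball around a point of s, on which a minimum exists by continuity. *)
Lemma radius_min s : s != set0 -> exists c, forall y, radius s c <= radius s y.
Proof.
move=> /set0Pn[i0 si0].
pose T := radius s 0.
have xT y : radius s y <= T -> closed_ball_ Num.norm (x i0) T y.
  move=> /radius_leP[T0 /(_ _ si0) yT]; rewrite /closed_ball_ /=.
  rewrite /Num.norm /= mx_normrE; apply: bigmax_le => // -[u j] _.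
  rewrite ord1 !mxE distrC; exact: le_trans (ler_coord_edist _ _ _) yT.
have compA : compact (closed_ball_ Num.norm (x i0) T).
  apply: bounded_closed_compact; last exact: closed_closed_ball_.
  exists (`|x i0| + T); split; first exact: num_real.
  move=> M MT y; rewrite /closed_ball_ /= => yT; apply/ltW.
  apply: le_lt_trans MT; rewrite -lerBlDl; apply: le_trans yT.
  by rewrite distrC; apply: lerB_dist.
have [|c _ cmin] := compact_EVT_min _ compA (continuous_subspaceT (@radius_continuous s)).
  by exists 0; apply: xT.
exists c => y; have [yT|Ty] := leP (radius s y) T.
  by apply: cmin; apply/mem_set/xT.
by apply: le_trans (ltW Ty); apply: cmin; apply/mem_set/xT.
Qed.

(** The infimum defining the birth time is attained, at a minimizing center. *)
Lemma mem_cech s t : (s \in cech x t) = (s != set0) && (birth_time x s <= t).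
Proof.
have [->|s0] /= := eqVneq s set0; first by rewrite inE eqxx.
have [c cmin] := radius_min s0.
suff -> : birth_time x s = radius s c.
  apply/idP/idP => [/mem_cech_radius[_ [y ys]]|sc].
    exact: le_trans (cmin y) ys.
  by apply/mem_cech_radius; split=> //; exists c.
have in_c : s \in cech x (radius s c) by apply/mem_cech_radius; split=> //; exists c.
have c0 : 0 <= radius s c by apply: bigmax_ge_id.
rewrite /birth_time; apply/eqP; rewrite eq_le; apply/andP; split.
  apply: ge_inf; last by split.
  by exists 0 => t' [].
apply: lb_le_inf; first by exists (radius s c).
by move=> t' [_ /mem_cech_radius[_ [y ys]]]; apply: le_trans (cmin y) ys.
Qed.

Lemma birth_time_ge0 s : 0 <= birth_time x s.
Proof.
rewrite /birth_time; have [A0|A0] := pselect ([set t | 0 <= t /\ s \in cech x t] !=set0)%classic.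
  by apply: lb_le_inf => // t [].
suff -> : [set t | 0 <= t /\ s \in cech x t]%classic = classical_sets.set0 by rewrite inf0.
by apply/seteqP; split=> t // st; case: A0; exists t.
Qed.

Lemma birth_time_mono s a : a \subset s -> a != set0 -> birth_time x a <= birth_time x s.
Proof.
move=> sub a0.
have: s \in cech x (birth_time x s).
  rewrite mem_cech lexx andbT; apply: contraNneq a0 => s0.
  by move: sub; rewrite s0 subset0.
case/mem_cech_radius=> s0 [y /radius_leP[t0 ys]].
suff: a \in cech x (birth_time x s) by rewrite mem_cech => /andP[].
apply/mem_cech_radius; split=> //; exists y; apply/radius_leP; split=> // i ai.
exact/ys/(subsetP sub).
Qed.

Lemma birth_time_vertex v : birth_time x [set v] = 0.
Proof.
apply/eqP; rewrite eq_le birth_time_ge0 andbT.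
suff: [set v] \in cech x 0 by rewrite mem_cech => /andP[].
apply/mem_cech_radius; split; first exact: singleton_neq0.
exists (x v); apply/radius_leP; split=> // i /set1P->.
by rewrite edist_refl.
Qed.

Lemma birth_time_le0 s : injective x -> s != set0 -> birth_time x s <= 0 ->
  exists v, s = [set v].
Proof.
move=> x_inj s0 b0; have: s \in cech x 0 by rewrite mem_cech s0.
case/mem_cech_radius=> _ [y /radius_leP[_ ys]].
have /set0Pn[v sv] := s0; exists v; apply/setP => w; rewrite inE.
apply/idP/eqP => [sw|->//]; apply: x_inj.
by rewrite -(edist_eq0 (ys _ sv)) -(edist_eq0 (ys _ sw)).
Qed.

Lemma mem_cech_before s t :
  (s \in cech_before x t) = (s != set0) && (birth_time x s < t).
Proof.
rewrite inE; apply/asboolP/andP => [[u [/andP[_ ut]]]|[s0 st]].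
  by rewrite mem_cech => /andP[-> su]; split=> //; apply: le_lt_trans ut.
exists (birth_time x s); rewrite birth_time_ge0 st; split=> //.
by rewrite mem_cech s0 lexx.
Qed.

End BirthTime.

(** * The Čech filtration *)

Section CechFiltration.
Context {R : realType} {N n : nat}.
Variable x : 'I_n -> 'rV[R]_N.
Hypotheses (n_gt0 : (0 < n)%N) (x_inj : injective x).
Implicit Types (s a : {set 'I_n}) (i : nat).

Local Notation f := (birth_time x).
Local Notation m := (size (births x)).

(** Indices from 0: [s] enters the filtration at stage [birth_index s].+1. *)
Definition birth_index s : nat := index (f s) (births x).

Lemma births_lt_sorted : sorted <%R (births x).
Proof. by rewrite sort_lt_sorted undup_uniq. Qed.

Lemma mem_births s : s != set0 -> f s \in births x.
Proof. by move=> s0; rewrite mem_sort mem_undup map_f // mem_enum inE. Qed.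

Lemma birthsP b : b \in births x -> exists2 s, s != set0 & f s = b.
Proof.
by rewrite mem_sort mem_undup => /mapP[s]; rewrite mem_enum inE => s0 ->; exists s.
Qed.

Lemma birth_index_lt s : s != set0 -> (birth_index s < m)%N.
Proof. by move=> s0; rewrite index_mem mem_births. Qed.

Lemma nth_birth_index s : s != set0 -> nth 0 (births x) (birth_index s) = f s.
Proof. by move=> s0; rewrite nth_index ?mem_births. Qed.

Lemma mem_stage i s : (i <= m)%N ->
  (s \in stage x i) = (s != set0) && (birth_index s < i)%N.
Proof.
case: i => [|i] im; first by rewrite inE ltn0 andbF.
rewrite mem_cech; apply: andb_id2l => s0.
rewrite -(nth_birth_index s0) /birth_value /= ltnS.
by rewrite (lt_sorted_leq_nth _ births_lt_sorted) ?inE // birth_index_lt.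
Qed.

Lemma stage_before i : (i < m)%N -> cech_before x (birth_value x i.+1) = stage x i.
Proof.
move=> im; apply/setP => s; rewrite mem_cech_before mem_stage; last exact: ltnW.
apply: andb_id2l => s0; rewrite -(nth_birth_index s0) /birth_value /=.
by rewrite (lt_sorted_ltn_nth _ births_lt_sorted) ?inE // birth_index_lt.
Qed.

Lemma set0_stage i : set0 \notin stage x i.
Proof. by case: i => [|i]; rewrite ?inE ?mem_cech ?eqxx. Qed.

Lemma simplicial_stage i : simplicial_complex (stage x i).
Proof.
case: i => [|i] s a; first by rewrite inE.
rewrite !mem_cech => /andP[s0 si] sub a0; rewrite a0.
exact: le_trans (birth_time_mono _ sub a0) si.
Qed.

Lemma stage_mono i : (i < m)%N -> stage x i \subset stage x i.+1.
Proof.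
move=> im; apply/subsetP => s; rewrite !mem_stage ?(ltnW im) //.
by case/andP=> -> /ltnW.
Qed.

Lemma births_size_gt0 : (0 < m)%N.
Proof.
exact: leq_ltn_trans (leq0n _) (birth_index_lt (singleton_neq0 (Ordinal n_gt0))).
Qed.

Lemma birth_index0 s : s != set0 -> (birth_index s == 0)%N = (f s == 0).
Proof.
have first0 : nth 0 (births x) 0 = 0.
  apply/eqP; rewrite eq_le; apply/andP; split; last first.
    have [s' _ <-] := birthsP (mem_nth 0 births_size_gt0); exact: birth_time_ge0.
  have v0 := singleton_neq0 (Ordinal n_gt0).
  rewrite -[leRHS](birth_time_vertex x (Ordinal n_gt0)) -[leRHS](nth_birth_index v0).
  rewrite (lt_sorted_leq_nth _ births_lt_sorted) ?inE ?births_size_gt0 //.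
  exact: birth_index_lt.
move=> s0; apply/eqP/eqP => [E|fs0]; first by rewrite -nth_birth_index // E.
apply/eqP; rewrite -(nth_uniq 0 (birth_index_lt s0) births_size_gt0).
  by rewrite nth_birth_index // first0 fs0.
by rewrite sort_uniq undup_uniq.
Qed.

Lemma stage1 : stage x 1 = vertices [set: 'I_n].
Proof.
apply/setP => s; rewrite mem_stage ?births_size_gt0 // ltnS leqn0.
apply/andP/imsetP => [[s0]|[v _ ->]].
  rewrite birth_index0 // => /eqP fs0.
  by have [|v ->] := birth_time_le0 x_inj s0; [rewrite fs0|exists v].
have v0 := singleton_neq0 v.
by rewrite v0 birth_index0 // birth_time_vertex.
Qed.

Lemma stage_full : stage x m = full_complex.
Proof.
apply/setP => s; rewrite mem_stage // inE; apply: andb_idr.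
exact: birth_index_lt.
Qed.

Lemma stage_diff i s : (i < m)%N ->
  (s \in stage x i.+1 :\: stage x i) = (s != set0) && (birth_index s == i).
Proof.
move=> im; rewrite in_setD !mem_stage ?(ltnW im) //.
by case: (s != set0) => //=; rewrite -leqNgt ltnS eqn_leq andbC.
Qed.

(** A critical simplex is born alone; the time t witnessing this can only be its
birth time. *)
Lemma critical_cells_stage q i a : (0 < i < m)%N ->
  (a \in critical_cells q (stage x i) (stage x i.+1)) =
  `[< critical x a >] && (#|a| == q.+1) && (birth_index a == i).
Proof.
move=> /andP[i0 im]; rewrite inE stage_diff // andbA [RHS]andbAC; congr (_ && _).
apply/andP/andP => [[/andP[a0 ai] /eqP Ka]|[/asboolP[t [t0 at_ Ka]] /eqP ai]].
  split=> //; apply/asboolP; exists (birth_value x i.+1); split.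
  - rewrite /birth_value /= -(eqP ai) nth_birth_index // lt_def birth_time_ge0 andbT.
    by rewrite -birth_index0 // (eqP ai) -lt0n.
  - by rewrite stage_before // mem_stage ?(ltnW im) // (eqP ai) ltnn andbF.
  by rewrite stage_before.
have : a \in cech x t by rewrite Ka setU11.
rewrite mem_cech => /andP[a0 fat]; have : f a = t.
  by apply/eqP; rewrite eq_le fat leNgt; move: at_; rewrite mem_cech_before a0.
rewrite -nth_birth_index // ai => bt.
by rewrite a0 eqxx -(stage_before im) /= /birth_value /= bt; split=> //; apply/eqP.
Qed.

Lemma critical_index a : critical x a -> (0 < birth_index a < m)%N.
Proof.
move=> [t [t0 at_ Ka]]; have : a \in cech x t by rewrite Ka setU11.
rewrite mem_cech => /andP[a0 fat]; rewrite birth_index_lt // andbT lt0n birth_index0 //.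
move: at_; rewrite mem_cech_before a0 /= -leNgt => tf.
by rewrite gt_eqF // (lt_le_trans t0).
Qed.

Lemma num_critical_sum q : num_critical x q =
  (\sum_(1 <= i < m) #|critical_cells q (stage x i) (stage x i.+1)|)%N.
Proof.
rewrite /num_critical; set A := [set a | _].
transitivity (\sum_(1 <= i < m) \sum_(a in A | birth_index a == i) 1)%N; last first.
  apply: eq_big_nat => i im; rewrite sum1_card; apply: eq_card => a.
  by rewrite critical_cells_stage // [LHS]unfold_in /= /A inE.
rewrite (exchange_big_dep (mem A)) /=; last by move=> i a _ /andP[].
rewrite -sum1_card; apply: eq_bigr => a aA.
rewrite (eq_bigl (fun i => i == birth_index a)); last first.
  by move=> i /=; rewrite aA eq_sym.
by rewrite big_nat1_eq critical_index //; move: aA; rewrite inE => /andP[/asboolP].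
Qed.

Section Gradient.
Variable V : {set {set {set 'I_n}}}.
Hypotheses (V_grad : discrete_gradient full_complex f V)
           (V_dist : distinct_interval_births f V).

(** A simplex born at positive time lies in a non-vertex interval, and two
non-vertex intervals with a common birth time coincide; so the simplices born at
a given positive time form a single interval. *)
Lemma stage_step i : (0 < i < m)%N ->
  exists t s : {set 'I_n}, t \subset s /\
    stage x i.+1 :\: stage x i = simplex_interval t s.
Proof.
move=> /andP[i0 im]; have [[Vpart Vint] _ Veq] := V_grad.
have [covV _ V0] := and3P Vpart.
have cover_V s : s != set0 -> exists2 I, I \in V & s \in I.
  move=> s0; have : s \in cover V by rewrite (eqP covV) inE.
  by case/bigcupP=> I VI sI; exists I.
have V_nonempty I s : I \in V -> s \in I -> s != set0.
  move=> VI sI; have : s \in cover V by apply/bigcupP; exists I.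
  by rewrite (eqP covV) inE.
(* Vertices have birth index 0, and i > 0. *)
have not_vertex I s : I \in V -> s \in I -> birth_index s = i -> ~ vertex_interval I.
  move=> VI sI si [v Iv]; move: sI si; rewrite Iv inE => /eqP-> vi.
  have v0 := singleton_neq0 v.
  by have := birth_index0 v0; rewrite vi birth_time_vertex eqxx (gtn_eqF i0).
have [s0 s00 fs0] := birthsP (mem_nth 0 im).
have is0 : birth_index s0 = i by rewrite /birth_index fs0 index_uniq ?sort_uniq ?undup_uniq.
have [I VI s0I] := cover_V s0 s00.
have [t [s [ts It]]] := Vint I VI.
have tI : t \in I by rewrite It inE subxx.
have const a : a \in I -> f a = f t.
  move=> aI; apply/esym/(Veq _ _ _ _ _).2.
  - by rewrite inE (V_nonempty I).
  - by rewrite inE (V_nonempty I).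
  - by move: aI; rewrite It inE => /andP[].
  by exists I.
exists t, s; split=> //; rewrite -It; apply/setP => a; rewrite stage_diff //.
apply/andP/idP => [[a0 /eqP ai]|aI]; last first.
  by rewrite (V_nonempty I) // /birth_index (const a aI) -(const s0 s0I) -/(birth_index s0) is0.
have [J VJ aJ] := cover_V a a0.
have [<-//|/eqP IJ] := eqVneq J I.
have [] := V_dist VJ VI IJ (not_vertex _ _ VJ aJ ai) (not_vertex _ _ VI s0I is0) aJ s0I.
by rewrite -nth_birth_index // -[RHS]nth_birth_index // ai is0.
Qed.

End Gradient.

Lemma size_persistence_diagram (F : fieldType) q :
  size (persistence_diagram F x q) =
  (\sum_(i <- iota 1 m) born F q (stage x i.-1) (stage x i))%N.
Proof.
rewrite -(size_barcode F stage_mono q) /persistence_diagram size_cat; congr (_ + _)%N.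
  rewrite size_flatten /shape map_allpairs sumnE big_allpairs_dep /=.
  by apply: eq_bigr => i _; apply: eq_bigr => j _; rewrite size_nseq.
rewrite size_flatten /shape -map_comp sumnE big_map /=.
by apply: eq_bigr => i _; rewrite size_nseq.
Qed.

End CechFiltration.

Theorem theorem3p2 (R : realType) (F : fieldType) (N n : nat)
    (x : 'I_n -> 'rV[R]_N) (n_gt0 : (0 < n)%N) (x_inj : injective x)
    (x_gen : general_position x)
    (V : {set {set {set 'I_n}}})
    (V_grad : discrete_gradient full_complex (birth_time x) V)
    (V_dist : distinct_interval_births (birth_time x) V) :
  size (persistence_diagram F x 0) = n /\
  forall q : nat, (1 <= q <= N.-1)%N ->
    (size (persistence_diagram F x q))%:Z =
      \sum_(1 <= k < q.+1) (-1) ^+ (q - k)%N * (num_critical x k)%:Z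
      + (-1) ^+ q * (n%:Z - 1).
Proof.
have cK i (_ : (i <= size (births x))%N) : simplicial_complex (stage x i).
  exact: simplicial_stage.
have step := stage_step n_gt0 V_grad V_dist.
have m_gt0 := births_size_gt0 x n_gt0; have K1 := stage1 n_gt0 x_inj.
split=> [|q /andP[q0 _]]; rewrite size_persistence_diagram.
  rewrite (born_sum F m_gt0 _ K1) //=.
  by have /= -> := born_total0 F cK (@stage_mono _ _ _ x) m_gt0 K1; rewrite addn0.
rewrite (born_sum_alternating F cK (@stage_mono _ _ _ x) (set0_stage x) m_gt0 _ K1
  (stage_full x) step (Ordinal n_gt0)) //; congr (_ + _).
by apply: eq_bigr => k _; rewrite (num_critical_sum x n_gt0).
Qed.
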